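(* Let $d\ge 1$, let $S\subseteq\mathbb{Z}^d$ be a finite set with $|S|\ge 3$, and let $s_0\in S$. Then there exists a finite AP-free colouring of $\mathbb{R}^d$ which contains no almost-monochromatic similar copy of $(S,s_0)$ if and only if $|S|>3$ and $s_0$ is not an extreme point of $S$.
   Context: A colouring is finite if it uses finitely many colours. An infinite arithmetic progression in $\mathbb{R}^d$ is a similar copy of $\mathbb{N}$, i.e. a set $\{a+mv: m\in\mathbb{N}\}$ with $a,v\in\mathbb{R}^d$, $v\neq 0$; a colouring is AP-free if it contains no monochromatic infinite arithmetic progression. A similar copy of $(S,s_0)$ is a pair $(f(S),f(s_0))$ where $f:\mathbb{R}^d\to\mathbb{R}^d$ is a similarity, $f(x)=\lambda Qx+c$ with $\lambda>0$, $Q$ orthogonal, $c\in\mathbb{R}^d$. A pair $(T,t_0)$ with $t_0\in T$ is almost-monochromatic (AM) if $T\setminus\{t_0\}$ is monochromatic but $T$ is not. The point $s_0$ is an extreme point of $S$ if $s_0\notin\operatorname{conv}(S\setminus\{s_0\})$. *)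

(* Defs.v *)
From HB Require Import structures.
From mathcomp Require Import all_boot all_order all_algebra finmap.
From mathcomp Require Import boolp classical_sets reals convex.

Set Implicit Arguments.
Unset Strict Implicit.
Unset Printing Implicit Defensive.

Import Order.TTheory GRing.Theory Num.Theory.

Local Open Scope classical_set_scope.
Local Open Scope ring_scope.

Section Defs.
Variables (R : realType) (d : nat).

Definition conv_hull (A : set 'cV[R]_d) : set 'cV[R]_d :=
  smallest (@convex_set R (convex_lmodType 'cV[R]_d)) A.

Definition extreme_point (S : set 'cV[R]_d) (s0 : 'cV[R]_d) : Prop :=
  ~ conv_hull (S `\ s0) s0.

Definition is_similarity (f : 'cV[R]_d -> 'cV[R]_d) : Prop :=
  exists (lambda : R) (Q : 'M[R]_d) (c : 'cV[R]_d),
    [/\ 0 < lambda, Q^T *m Q = 1%:M & forall x, f x = lambda *: (Q *m x) + c].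

(* The family of progressions is the same whether nat starts at 0 or at 1:
   replace a by a - v. *)
Definition is_AP (A : set 'cV[R]_d) : Prop :=
  exists a v : 'cV[R]_d, v != 0 /\ A = range (fun m : nat => a + m%:R *: v).

Definition similar_copy (S : set 'cV[R]_d) (s0 : 'cV[R]_d)
    (T : set 'cV[R]_d) (t0 : 'cV[R]_d) : Prop :=
  exists f, [/\ is_similarity f, T = f @` S & t0 = f s0].

Section Colouring.
Variables (C : Type) (chi : 'cV[R]_d -> C).

Definition monochromatic (A : set 'cV[R]_d) : Prop :=
  forall x y, A x -> A y -> chi x = chi y.

Definition AP_free : Prop := forall A, is_AP A -> ~ monochromatic A.

Definition almost_monochromatic (T : set 'cV[R]_d) (t0 : 'cV[R]_d) : Prop :=
  [/\ T t0, monochromatic (T `\ t0) & ~ monochromatic T].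

End Colouring.

End Defs.

(* Main.v *)
Require Import Defs.
From mathcomp Require Import all_boot all_order all_algebra finmap.
From mathcomp Require Import zify ring lra interval_inference.
From mathcomp Require Import boolp classical_sets reals convex.
Set Implicit Arguments.
Unset Strict Implicit.
Unset Printing Implicit Defensive.
Import Order.TTheory GRing.Theory Num.Theory.
Local Open Scope ring_scope.

(** Suppose that an AP-free finite colouring has no almost-monochromatic (AM)
    copy.

    If [s0] is extreme, [s0] can be separated from the other points of [S].
    Gallai's theorem gives a large monochromatic ball of a scaled lattice.  Just
    outside a large ball of lattice points one can place [f s0] with the other
    points of [f S] inside the ball, [f] ranging over finitely many integral
    similarities built from reflections along integer vectors; hence the colour
    spreads to the whole lattice, which contains infinite progressions.

    If [S] consists of [s0] strictly between two other points, then after a long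
    maximal monochromatic progression some infinite progression avoids its colour
    altogether, and one concludes by induction on the number of colours.

    In the remaining case, cut the shells between half-open boxes of doubling size
    into small cubes, and colour a point by its cube and by the index of its shell
    modulo a large number.  Points of one colour lying in different cells are much
    farther apart than points of one cell, so at least three points of [f S] of
    one colour must share a cell; cells being convex, [f s0] lies there too. *)

(** * Gallai's theorem *)

(* All witnesses come from one finite list, so that finitely many translates of
   a finite colouring again make up a finite colouring. *)
Definition finitely_gallai (V : nmodType) (F : seq V) :=
  forall C : finType, exists L : seq (V * nat), forall chi : V -> C,
  exists c t, [/\ (c, t) \in L, (0 < t)%N &
    exists col, forall f, f \in F -> chi (c + f *+ t) = col].

(* In the second alternative the [r] copies of [F] have distinct colours and are all
   completed by the same point [q], whose colour is therefore a new one. *)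
Lemma colour_focusing (V : nmodType) (F : seq V) (f0 : V) (C : finType) :
  finitely_gallai F ->
  forall r, exists L : seq (V * nat), exists X : seq V, forall chi : V -> C,
  (exists c t, [/\ (c, t) \in L, (0 < t)%N &
     exists col, forall f, f \in f0 :: F -> chi (c + f *+ t) = col]) \/
  (exists q, q \in X /\ exists D : {set C}, #|D| = r /\
     forall col, col \in D -> exists c t, [/\ (c, t) \in L, (0 < t)%N,
       c + f0 *+ t = q & forall f, f \in F -> chi (c + f *+ t) = col]).
Proof.
move=> gF; elim=> [|r [L [X IH]]].
  exists [::], [:: 0] => chi; right; exists 0; split; first by rewrite mem_head.
  by exists finset.set0; split=> [|col]; rewrite ?cards0 // inE.
pose Y := X ++ [seq x.1 + f *+ x.2 | x <- L, f <- F].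
(* A colour of this product palette is the pattern of [chi] on a whole translate of [Y]. *)
have [M HM] := gF {ffun 'I_(size Y) -> C}.
(* [L1] collects copies found inside one translate, [L2] focused copies fused with the outer copy
   (the scales add up), and [L3] the outer copy shifted by a focus, which carries the new colour. *)
pose L1 := [seq (m.1 + head 0 F *+ m.2 + x.1, x.2) | m <- M, x <- L].
pose L2 := [seq (m.1 + x.1, (m.2 + x.2)%N) | m <- M, x <- L].
pose L3 := [seq (m.1 + x, m.2) | m <- M, x <- X].
exists (L1 ++ L2 ++ L3), [seq m.1 + f0 *+ m.2 + x | m <- M, x <- X] => chi.
have [c [t [ct_M t_gt0 [pat Hpat]]]] :=
  HM (fun v => [ffun i : 'I_(size Y) => chi (v + nth 0 Y i)]).
(* The pattern seen alike from all points [c + f *+ t] with [f] in [F]; the default of [head] is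
   reached only for empty [F], where this agreement is vacuous. *)
pose psi y := chi (c + head 0 F *+ t + y).
have tr f y : f \in F -> y \in Y -> chi (c + f *+ t + y) = psi y.
  move=> fF yY; have yi : (index y Y < size Y)%N by rewrite index_mem.
  have hF : head 0 F \in F by case: (F) fF => //= a l _; rewrite mem_head.
  have := congr1 (fun g : {ffun _ -> _} => g (Ordinal yi))
            (etrans (Hpat f fF) (esym (Hpat _ hF))).
  by rewrite !ffunE /= nth_index.
have found c1 t1 col : (c1, t1) \in L -> (0 < t1)%N ->
    (forall f, f \in f0 :: F -> psi (c1 + f *+ t1) = col) ->
    exists c' t', [/\ (c', t') \in L1 ++ L2 ++ L3, (0 < t')%N &
     exists col, forall f, f \in f0 :: F -> chi (c' + f *+ t') = col].
  move=> L_1 t1_gt0 H; exists (c + head 0 F *+ t + c1), t1; split=> //.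
    rewrite mem_cat; apply/orP; left; apply/allpairsP.
    by exists ((c, t), (c1, t1)).
  by exists col => f /H <-; rewrite /psi !addrA.
have [[c1 [t1 [L_1 t1_gt0 [col H]]]]|[q [qX [D [cardD HD]]]]] := IH psi.
  by left; apply: found L_1 t1_gt0 H.
(* Either the focus completes a copy that already has its colour, or it contributes a new colour. *)
have [qD|qD] := boolP (psi q \in D).
  have [c1 [t1 [L_1 t1_gt0 cq H]]] := HD _ qD.
  left; apply: (found c1 t1 (psi q)) => // f.
  by rewrite inE => /orP[/eqP->|/H//]; rewrite cq.
right; exists (c + f0 *+ t + q); split.
  by apply/allpairsP; exists ((c, t), q).
exists (psi q |: D)%SET; split; first by rewrite cardsU1 qD cardD.
move=> col; rewrite !inE => /orP[/eqP->|colD].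
  exists (c + q), t; split=> //.
  - rewrite !mem_cat; apply/orP; right; apply/orP; right.
    by apply/allpairsP; exists ((c, t), q).
  - by rewrite addrAC.
  - by move=> f fF; rewrite addrAC tr // mem_cat qX.
have [c1 [t1 [L_1 t1_gt0 cq H]]] := HD _ colD.
exists (c + c1), (t + t1)%N; split.
- rewrite !mem_cat; apply/orP; right; apply/orP; left.
  by apply/allpairsP; exists ((c, t), (c1, t1)).
- by rewrite addn_gt0 t_gt0.
- by rewrite mulrnDr addrACA cq.
move=> f fF; rewrite mulrnDr addrACA tr ?H // mem_cat; apply/orP; right.
by apply/allpairsP; exists ((c1, t1), f).
Qed.

(** Points are added one at a time; focusing more copies than there are colours is impossible, so
    the first alternative of [colour_focusing] must hold. *)
Lemma finitely_gallaiT (V : nmodType) (F : seq V) : finitely_gallai F.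
Proof.
elim: F => [|f0 F IH] C.
  exists [:: (0, 1%N)] => chi; exists 0, 1%N; split=> //; first exact: mem_head.
  by exists (chi 0).
have [L [X HL]] := colour_focusing f0 C IH #|C|.+1.
exists L => chi; have [//|[q [_ [D [cardD _]]]]] := HL chi.
by have := max_card (mem D); rewrite cardD ltnn.
Qed.

Lemma gallai (V : nmodType) (C : finType) (F : seq V) (chi : V -> C) :
  exists c t, (0 < t)%N /\
    exists col, forall f, f \in F -> chi (c + f *+ t) = col.
Proof.
have [L HL] := finitely_gallaiT F C.
by have [c [t [_ t_gt0 mono]]] := HL chi; exists c, t.
Qed.

(* In a maximal monochromatic progression of colour [g a] and length [M >= p + q],
   the colour [g a] does not occur among the [M + q * i]: an occurrence at [i > 0]
   yields one at [(p * i - 1) %/ (p + q) < i]. So some infinite progression uses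
   fewer colours. *)
Lemma three_point_AP (C : finType) (p q : nat) (g : nat -> C) :
  (0 < p)%N -> (0 < q)%N ->
  (forall y j, (0 < j)%N -> g y = g (y + (p + q) * j)%N ->
     g (y + p * j)%N = g y) ->
  exists a v, (0 < v)%N /\ forall m, g (a + v * m)%N = g a.
Proof.
move=> p_gt0 q_gt0 rule.
(* Induction on the number of colours available along some progression. *)
suff: forall k (D : {set C}), (#|D| <= k)%N -> forall a v, (0 < v)%N ->
    (forall m, g (a + v * m)%N \in D) ->
    exists a v, (0 < v)%N /\ forall m, g (a + v * m)%N = g a.
  by move=> H; apply: (H _ [set: C]%SET (leqnn _) 0%N 1%N).
elim=> [|k IHk] D Dk a v v_gt0 gD.
  by move: Dk (gD 0%N); rewrite leqn0 cards_eq0 => /eqP->; rewrite inE.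
have [c [t [t_gt0 [col Hcol]]]] :=
  gallai (iota 0 (p + q)) (fun m : nat => g (a + v * m)%N).
pose a1 := (a + v * c)%N; pose w := (v * t)%N.
have w_gt0 : (0 < w)%N by rewrite muln_gt0 v_gt0.
have ga1 m : (m < p + q)%N -> g (a1 + w * m)%N = col.
  move=> mn; rewrite -(Hcol m) ?mem_iota //; congr (g _).
  rewrite -mulr_natr natn /a1 /w; lia.
have [allred|/existsNP exM] := pselect (forall m, g (a1 + w * m)%N = col).
  exists a1, w; split=> // m; rewrite allred -(allred 0%N); congr (g _); lia.
have exM' : exists m, g (a1 + w * m)%N != col.
  by have [m /eqP Hm] := exM; exists m.
have [M HM minM] := ex_minnP exM'.
have redM m : (m < M)%N -> g (a1 + w * m)%N = col.
  by move=> mM; apply/eqP; apply: contraTT mM => /minM; rewrite -leqNgt.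
have nM : (p + q <= M)%N.
  by rewrite leqNgt; apply: contraNN HM => /ga1 ->.
pose b := (a1 + w * M)%N.
have nonred i : g (b + w * q * i)%N != col.
  elim/ltn_ind: i => i IHi; case: (posnP i) => [->|i_gt0].
    by rewrite muln0 addn0.
  apply/negP => /eqP redi.
  pose i' := ((p * i).-1 %/ (p + q))%N.
  have pi_gt0 : (0 < p * i)%N by rewrite muln_gt0 p_gt0.
  have lei' : ((p + q) * i' < p * i)%N.
    by rewrite mulnC; have := leq_divM (p * i).-1 (p + q); rewrite -/i'; lia.
  have gei' : (p * i <= (p + q) * i' + (p + q))%N.
    have := ltn_ceil (p * i).-1 (_ : 0 < p + q)%N.
    by rewrite addn_gt0 p_gt0 => /(_ isT); rewrite -/i' mulSn mulnC; lia.
  have i'i : (i' < i)%N by nia.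
  (* The position for which [M + q * i'] divides the segment from [y] to [M + q * i] in the ratio
     [p : q]. The bounds on [i'], with [p + q <= M], give [y < M] and keep the subtraction from
     truncating. *)
  pose y := (M + (p + q) * i' - p * i)%N.
  have yM : (y < M)%N by rewrite /y; lia.
  have := IHi _ i'i; apply/negP; rewrite negbK -(redM _ yM).
  have E1 : (b + w * q * i' = a1 + w * y + p * (w * (i - i')))%N.
    rewrite /b /y mulnBr; nia.
  have E2 : (b + w * q * i = a1 + w * y + (p + q) * (w * (i - i')))%N.
    rewrite /b /y; nia.
  rewrite E1; apply/eqP; apply: rule.
    by rewrite muln_gt0 w_gt0 subn_gt0.
  by rewrite -E2 redi redM.
apply: (IHk (D :\ col)%SET _ b (w * q)%N).
- have := cardsD1 col D; rewrite -(ga1 0%N) ?addn_gt0 ?p_gt0 //.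
  have -> : g (a1 + w * 0)%N \in D by rewrite muln0 addn0 /a1 gD.
  by rewrite add1n => E; move: Dk; rewrite E ltnS.
- by rewrite muln_gt0 w_gt0.
move=> m; rewrite !inE nonred /=.
suff -> : (b + w * q * m = a + v * (c + t * (M + q * m)))%N by exact: gD.
rewrite /b /a1 /w; lia.
Qed.

(** * Separation of an extreme point *)

Section Dot.
Variables (R : realFieldType) (d : nat).
Implicit Types (u v w : 'cV[R]_d) (a : R) (A : 'M[R]_d).

Definition dot u v : R := (u^T *m v) 0 0.

Lemma dotE u v : dot u v = \sum_i u i 0 * v i 0.
Proof. by rewrite /dot mxE; apply: eq_bigr => i _; rewrite mxE. Qed.

Lemma dotC u v : dot u v = dot v u.
Proof. by rewrite !dotE; apply: eq_bigr => i _; rewrite mulrC. Qed.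

Lemma dotDr u v w : dot u (v + w) = dot u v + dot u w.
Proof. by rewrite /dot mulmxDr mxE. Qed.

Lemma dotDl u v w : dot (u + v) w = dot u w + dot v w.
Proof. by rewrite dotC dotDr dotC (dotC w). Qed.

Lemma dotZr a u v : dot u (a *: v) = a * dot u v.
Proof. by rewrite /dot -scalemxAr mxE. Qed.

Lemma dotZl a u v : dot (a *: u) v = a * dot u v.
Proof. by rewrite dotC dotZr dotC. Qed.

Lemma dotNr u v : dot u (- v) = - dot u v.
Proof. by rewrite -scaleN1r dotZr mulN1r. Qed.

Lemma dotNl u v : dot (- u) v = - dot u v.
Proof. by rewrite dotC dotNr dotC. Qed.

Lemma dot0r u : dot u 0 = 0.
Proof. by rewrite -(scale0r 0) dotZr mul0r. Qed.

Lemma dot_sumr (I : Type) (r : seq I) (F : I -> 'cV[R]_d) u :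
  dot u (\sum_(i <- r) F i) = \sum_(i <- r) dot u (F i).
Proof.
elim: r => [|i r IH]; rewrite ?big_nil ?dot0r // !big_cons dotDr.
by rewrite IH.
Qed.

Lemma dot_ge0 u : 0 <= dot u u.
Proof. by rewrite dotE sumr_ge0 // => i _; rewrite -expr2 sqr_ge0. Qed.

Lemma sqr_coord_le_dot u i : u i 0 ^+ 2 <= dot u u.
Proof.
rewrite dotE (bigD1 i) //= expr2 lerDl sumr_ge0 // => j _.
by rewrite -expr2 sqr_ge0.
Qed.

Lemma dot_eq0 u : (dot u u == 0) = (u == 0).
Proof.
apply/idP/eqP => [/eqP u0|->]; last by rewrite dot0r.
apply/matrixP => i j; rewrite ord1 mxE; apply/eqP; rewrite -sqrf_eq0.
by rewrite eq_le sqr_ge0 andbT -u0 sqr_coord_le_dot.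
Qed.

Lemma dot_gt0 u : u != 0 -> 0 < dot u u.
Proof. by move=> u0; rewrite lt_neqAle eq_sym dot_eq0 u0 dot_ge0. Qed.

Lemma dot_mulmx A u v : A^T *m A = 1%:M -> dot (A *m u) (A *m v) = dot u v.
Proof. by move=> AA; rewrite /dot trmx_mul -mulmxA [A^T *m _]mulmxA AA mul1mx. Qed.

Lemma normr_dot_le u v a b : 0 <= a ->
  (forall i, `|u i 0| <= a) -> (forall i, `|v i 0| <= b) ->
  `|dot u v| <= d%:R * (a * b).
Proof.
move=> a0 ua vb; rewrite dotE (le_trans (ler_norm_sum _ _ _)) //.
have <- : \sum_(i < d) a * b = d%:R * (a * b).
  by rewrite sumr_const card_ord mulr_natl.
by apply: ler_sum => i _; rewrite normrM ler_pM.
Qed.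

(* Gordan's alternative, by projecting all vectors along one of them. *)
Lemma gordan (I : eqType) (s : seq I) (g : I -> 'cV[R]_d) : uniq s ->
  (exists u, forall i, i \in s -> 0 < dot u (g i)) \/
  (exists c : I -> R, [/\ forall i, i \in s -> 0 <= c i,
     exists2 i, i \in s & 0 < c i & \sum_(i <- s) c i *: g i = 0]).
Proof.
elim: s g => [|k s IH] g /=; first by left; exists 0.
move=> /andP[ks us].
have ext (c : I -> R) a :
    let c' i := if i == k then a else c i in
    \sum_(i <- k :: s) c' i *: g i = a *: g k + \sum_(i <- s) c i *: g i.
  rewrite /= big_cons eqxx; congr (_ + _); rewrite !big_seq.
  by apply: eq_bigr => i si; case: eqP si ks => // -> ->.
have ne i : i \in s -> (i == k) = false.
  by move=> si; apply: contraNF ks => /eqP <-.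
have [gk0|gk0] := eqVneq (g k) 0.
  right; exists (fun i => if i == k then 1 else 0); split.
  - by move=> i _; case: ifP.
  - by exists k; rewrite ?mem_head ?eqxx.
  - rewrite (ext (fun=> 0)) gk0 scaler0 add0r.
    by rewrite big1 // => i _; rewrite scale0r.
pose n := dot (g k) (g k); have n_gt0 : 0 < n by apply: dot_gt0.
pose proj w := w - (dot (g k) w / n) *: g k.
have projK w : dot (g k) (proj w) = 0.
  by rewrite dotDr dotNr dotZr divfK ?gt_eqF // subrr.
have dep (c : I -> R) : (forall i, i \in s -> 0 <= c i) ->
    (exists2 i, i \in s & 0 < c i) -> \sum_(i <- s) c i *: g i = 0 ->
    exists c : I -> R, [/\ forall i, i \in k :: s -> 0 <= c i,
     exists2 i, i \in k :: s & 0 < c i & \sum_(i <- k :: s) c i *: g i = 0].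
  move=> c0 [i si ci] cg; exists (fun i => if i == k then 0 else c i); split.
  - by move=> j; rewrite inE; case: eqP => //= _ /c0.
  - by exists i; rewrite ?inE ?si ?orbT // ne.
  - by rewrite ext scale0r add0r.
have [[u Hu]|[c [c0 [i0 si0 ci0] cg]]] := IH (proj \o g) us.
  left; pose u' := proj u.
  have u's i : i \in s -> 0 < dot u' (g i).
    move=> /Hu /=; rewrite /u' /proj !(dotDl, dotDr, dotNl, dotNr, dotZr, dotZl).
    suff -> : dot (g k) u / n * dot (g k) (g i) =
              dot (g k) (g i) / n * dot u (g k) by [].
    by rewrite mulrAC [RHS]mulrAC (dotC u) [X in X / n]mulrC.
  (* As [u'] is orthogonal to [g k], a large multiple of it can be added to [g k] to outweigh all
     the products [dot (g k) (g i)]. *)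
  pose M := \sum_(i <- s) `|dot (g k) (g i)| / dot u' (g i).
  have M0 : 0 <= M.
    rewrite /M big_seq sumr_ge0 // => i si.
    by rewrite divr_ge0 // ltW // u's.
  exists (g k + (M + 1) *: u') => i; rewrite inE => /orP[/eqP->|si].
    by rewrite dotDl dotZl (dotC u') projK mulr0 addr0.
  rewrite dotDl dotZl mulrDl mul1r addrA ltr_wpDl ?u's //.
  suff : `|dot (g k) (g i)| <= M * dot u' (g i).
    by move=> le_M; have := ler_norm (- dot (g k) (g i)); rewrite normrN; lra.
  rewrite -ler_pdivrMr ?u's // /M (big_rem i) //= lerDl big_seq sumr_ge0 // => j.
  by move=> /mem_rem sj; rewrite divr_ge0 // ltW // u's.
(* Lifting the dependency between projections leaves a multiple [a] of [g k]. If [a <= 0], moving it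
   across gives a dependency; if [a > 0], any [u] positive on the tail is positive on [g k] too. *)
pose a := \sum_(i <- s) c i * (dot (g k) (g i) / n).
have cga : \sum_(i <- s) c i *: g i = a *: g k.
  apply/eqP; rewrite -subr_eq0 scaler_suml -sumrB -[X in _ == X]cg; apply/eqP.
  by apply: eq_bigr => i _; rewrite /proj /= scalerBr scalerA.
have [a_le0|a_gt0] := leP a 0.
  right; exists (fun i => if i == k then - a else c i); split.
  - by move=> j; rewrite inE; case: eqP => [_ _|_ /c0//]; rewrite oppr_ge0.
  - by exists i0; rewrite ?inE ?si0 ?orbT // ne.
  - by rewrite ext cga scaleNr addNr.
have [[u Hu]|[c' [c'0 c'p c'g]]] := IH g us; last by right; apply: dep c'g.
left; exists u => i; rewrite inE => /orP[/eqP->|/Hu//].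
rewrite -(pmulr_rgt0 _ a_gt0) -dotZr -cga dot_sumr (big_rem i0) //=.
rewrite dotZr ltr_wpDr ?mulr_gt0 ?Hu // big_seq sumr_ge0 // => j /mem_rem sj.
by rewrite dotZr mulr_ge0 ?c0 // ltW // Hu.
Qed.

End Dot.

Lemma convex_setP (R : realType) (V : lmodType R) (A : set V) :
  @convex_set R V A <->
  forall x y l, A x -> A y -> 0 <= l -> l <= 1 -> A (l *: x + (1 - l) *: y).
Proof.
split=> [cA x y l /mem_set Ax /mem_set Ay l0 l1|cA x y l /set_mem Ax /set_mem Ay].
  exact/set_mem/(cA x y (Itv01 l0 l1)).
by apply/mem_set; apply: cA.
Qed.

(** The weights are normalised only at the end, so that coefficients from [gordan] can be used as
    they come. The tail is averaged first, then combined with the head; a tail of total weight zero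
    is treated apart. *)
Lemma convex_set_sum (R : realType) (V : lmodType R) (A : set V) (I : eqType)
    (s : seq I) (g : I -> V) (c : I -> R) :
  @convex_set R V A -> (forall i, i \in s -> A (g i)) ->
  (forall i, i \in s -> 0 <= c i) -> 0 < \sum_(i <- s) c i ->
  A ((\sum_(i <- s) c i)^-1 *: \sum_(i <- s) c i *: g i).
Proof.
move=> /convex_setP cA; elim: s => [|k s IH] gA c0.
  by rewrite big_nil ltxx.
rewrite !big_cons; set a := \sum_(i <- s) c i.
have a_ge0 : 0 <= a.
  by rewrite /a big_seq sumr_ge0 // => i si; rewrite c0 // inE si orbT.
have ck : 0 <= c k by rewrite c0 ?mem_head.
move=> T0; have [a0|a_neq0] := eqVneq a 0.
  have -> : \sum_(i <- s) c i *: g i = 0.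
    rewrite big_seq big1 // => i si; suff -> : c i = 0 by rewrite scale0r.
    apply/eqP; rewrite eq_le c0 ?inE ?si ?orbT // andbT -a0 /a (big_rem i) //=.
    rewrite lerDl big_seq sumr_ge0 // => j /mem_rem sj.
    by rewrite c0 // inE sj orbT.
  move: T0; rewrite a0 !addr0 => ck0.
  by rewrite scalerA mulVf ?gt_eqF // scale1r; apply: gA; rewrite mem_head.
have a_gt0 : 0 < a by rewrite lt_neqAle eq_sym a_neq0.
have tail : A (a^-1 *: \sum_(i <- s) c i *: g i).
  by apply: IH => // i si; [apply: gA|apply: c0]; rewrite inE si orbT.
have := cA _ _ (c k / (c k + a)) (gA k (mem_head _ _)) tail.
rewrite divr_ge0 ?(ltW T0) // ler_pdivrMr // mul1r lerDl a_ge0 => /(_ isT isT).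
rewrite scalerDr !scalerA [_^-1 * c k]mulrC.
suff -> : (1 - c k / (c k + a)) / a = (c k + a)^-1 by [].
by field; rewrite a_neq0 gt_eqF.
Qed.

(** * Integral similarities *)

Section Reflection.
Variables (R : realFieldType) (d : nat).
Implicit Types (u v w p : 'cV[R]_d).

(* [dot w w] times the reflection in the hyperplane orthogonal to [w]; the
   factor makes it integral for integral [w]. *)
Definition scaled_reflection w : 'M[R]_d := (dot w w)%:M - 2 *: (w *m w^T).

Lemma scaled_reflectionE w v :
  scaled_reflection w *m v = dot w w *: v - (2 * dot w v) *: w.
Proof.
rewrite mulmxBl mul_scalar_mx -scalemxAl -mulmxA.
by rewrite (mx11_scalar (w^T *m v)) mul_mx_scalar scalerA.
Qed.

(** The matrix is symmetric and is [dot w w] times an involution; divided by that factor, it is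
    orthogonal for nonzero [w]. *)
Lemma scaled_reflection_gram w :
  (scaled_reflection w)^T *m scaled_reflection w = (dot w w ^+ 2)%:M.
Proof.
have -> : (scaled_reflection w)^T = scaled_reflection w.
  by rewrite linearB linearZ /= tr_scalar_mx trmx_mul trmxK.
rewrite {2}/scaled_reflection mulmxBr mul_mx_scalar -scalemxAr mulmxA.
rewrite scaled_reflectionE -scalerBl mulrDl mul1r opprD addrA subrr sub0r.
rewrite -scalemxAl scalerA /scaled_reflection scalerBr scale_scalar_mx expr2 scalerA.
by rewrite mulrN scaleNr opprK [2 * _]mulrC subrK.
Qed.

End Reflection.

(** * Descent towards the origin by integral similarities *)

Section Descent.
Variables (R : realType) (d : nat).
Implicit Types (u v w p z : 'cV[R]_d).

Lemma scaled_reflection_int w : w \is a mxOver Num.int ->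
  scaled_reflection w \is a mxOver Num.int.
Proof.
move=> w_int; have wT_int : w^T \is a mxOver Num.int.
  by apply/mxOverP => i j; rewrite mxE; apply/mxOverP.
apply/mxOverP => i j; rewrite mxE [X in _ + X]mxE rpredB //; apply/mxOverP.
  by rewrite mxOver_scalar ?rpred0 //; apply/mxOverP; rewrite mxOverM.
by rewrite mxOverZ ?mxOverM ?rpred_nat.
Qed.

Lemma unit_coord_le1 p i : dot p p = 1 -> `|p i 0| <= 1.
Proof.
move=> p1; rewrite -(@ler_pXn2r _ 2) ?nnegrE // expr1n -normrX ger0_norm ?sqr_ge0 //.
by rewrite -p1 sqr_coord_le_dot.
Qed.

(* The reflection in the hyperplane orthogonal to [u + p] sends [u] to [- p];
   [w] is [N * (u + p)] with its coordinates rounded. *)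
Lemma rounded_reflection u p (eta a : R) (N : nat) :
  dot u u = 1 -> dot p p = 1 -> 2 <= dot (u + p) (u + p) ->
  0 < eta -> 0 <= a -> 15 * d%:R ^+ 2 * a <= N%:R * eta -> (0 < N)%N ->
  exists w, [/\ w \is a mxOver Num.int, forall i, `|w i 0| <= 3 * N%:R &
    forall v, (forall i, `|v i 0| <= a) -> eta <= dot u v ->
      dot p (scaled_reflection w *m v) <= - (N%:R ^+ 2 * eta)].
Proof.
move=> u1 p1 up2 eta_gt0 a_ge0 N_large N_gt0.
pose x := N%:R *: (u + p).
pose w : 'cV[R]_d := \col_i (Num.floor (x i 0))%:~R.
pose e := w - x.
have N1 : 1 <= N%:R :> R by rewrite ler1n.
have eb i : `|e i 0| <= 1.
  rewrite !mxE; set y := (X in (Num.floor X)%:~R - X).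
  by have := floor_itv y; rewrite ler_norml intrD; lra.
have pb i : `|p i 0| <= 1 by apply: unit_coord_le1.
have xb i : `|x i 0| <= 2 * N%:R.
  rewrite !mxE normrM normr_nat mulrC ler_pM // (le_trans (ler_normD _ _)) //.
  by have := unit_coord_le1 i u1; have := pb i; lra.
have wE : w = x + e by rewrite addrC subrK.
exists w; split.
- by apply/mxOverP => i j; rewrite mxE intr_int.
- move=> i; rewrite wE [(x + e) i 0]mxE (le_trans (ler_normD _ _)) //.
  by have := xb i; have := eb i; lra.
move=> v vb uv; rewrite scaled_reflectionE dotDr dotNr !dotZr.
have mulb (b c B C : R) : `|b| <= B -> `|c| <= C ->
    b * c <= B * C /\ - (B * C) <= b * c.
  move=> bB cC; have : `|b * c| <= B * C by rewrite normrM ler_pM.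
  by rewrite ler_norml => /andP[].
have D0 : 0 <= d%:R :> R by [].
have N2 : 0 <= 2 * N%:R :> R by lra.
have pv := normr_dot_le ler01 pb vb.
have ev := normr_dot_le ler01 eb vb.
have ep := normr_dot_le ler01 eb pb.
have ee := normr_dot_le ler01 eb eb.
have xe := normr_dot_le N2 xb eb.
have xp := normr_dot_le N2 xb pb.
have xv := normr_dot_le N2 xb vb.
(* The value without rounding: reflecting in [u + p] turns the product with [p] into minus the
   product with [u], since both are unit vectors. *)
have main : dot x x * dot p v - 2 * (dot x p * dot x v) =
    - (N%:R ^+ 2 * (dot (u + p) (u + p) * dot u v)).
  rewrite /x !(dotZl, dotZr, dotDl, dotDr) (dotC p u) u1 p1; ring.
have main' : N%:R ^+ 2 * (2 * eta) <= N%:R ^+ 2 * (dot (u + p) (u + p) * dot u v).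
  by rewrite ler_pM2l ?exprn_gt0 ?ler_pM ?(ltW eta_gt0) //; lra.
have [h1 _] := mulb _ _ _ _ xe pv.
have [h2 _] := mulb _ _ _ _ ee pv.
have [_ h3] := mulb _ _ _ _ xp ev.
have [_ h4] := mulb _ _ _ _ ep xv.
have [_ h5] := mulb _ _ _ _ ep ev.
(* Rounding costs at most [12 * N * d^2 * a] from the terms linear in [e] and [3 * d^2 * a] from the
   others, whence the constant 15. *)
have N_large' : N%:R * (15 * d%:R ^+ 2 * a) <= N%:R * (N%:R * eta).
  by rewrite ler_pM2l ?ltr0n.
have d2a : 3 * (d%:R ^+ 2 * a) <= N%:R * (3 * (d%:R ^+ 2 * a)).
  by rewrite ler_peMl ?mulr_ge0 ?exprn_ge0.
clearbody e w x; rewrite wE !(dotDl, dotDr)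
  (dotC e x) (dotC p x) (dotC p e).
move: h1 h2 h3 h4 h5 main main' N_large' d2a.
move: (dot (u + p) (u + p)) (dot u v) (dot x x) (dot p v) (dot x p) (dot x v)
  (dot x e) (dot e e) (dot e v) (dot e p) => ? ? ? ? ? ? ? ? ? ?.
lra.
Qed.

Lemma seq_pos_bound (I : eqType) (s : seq I) (f : I -> R) :
  (forall i, i \in s -> 0 < f i) ->
  exists2 e, 0 < e & forall i, i \in s -> e <= f i.
Proof.
elim: s => [|k s IH] f_gt0; first by exists 1.
have [i si|e e_gt0 He] := IH; first by rewrite f_gt0 // inE si orbT.
exists (Num.min e (f k)).
  by rewrite lt_min e_gt0 f_gt0 ?mem_head.
by move=> i; rewrite inE ge_min => /orP[/eqP->|/He->//]; rewrite lexx orbT.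
Qed.

Lemma seq_bound (I : eqType) (s : seq I) (f : I -> R) :
  exists2 a, 0 <= a & forall i, i \in s -> f i <= a.
Proof.
exists (\sum_(i <- s) `|f i|); first by rewrite sumr_ge0.
move=> i si; rewrite (big_rem i) //= (le_trans (ler_norm _)) // lerDl.
by rewrite sumr_ge0.
Qed.

(* Far from the origin the sphere through [z] is nearly flat at the scale of the
   bounded similarities used here, so [z + A *m v] falls strictly inside it. *)
Lemma sphere_descent (s : seq 'cV[R]_d) u v0 : v0 \in s ->
  (forall v, v \in s -> 0 < dot u v) ->
  exists B : R, forall z, B <= dot z z -> exists (A : 'M[R]_d) (mu : R),
    [/\ A \is a mxOver Num.int, 0 < mu, A^T *m A = (mu ^+ 2)%:M &
      forall v, v \in s -> dot (z + A *m v) (z + A *m v) < dot z z].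
Proof.
move=> sv0 us; have u0 : u != 0.
  by apply: contraTneq (us _ sv0) => ->; rewrite dotC dot0r ltxx.
have uu_gt0 := dot_gt0 u0.
have normalize v : 0 < dot v v ->
    dot ((Num.sqrt (dot v v))^-1 *: v) ((Num.sqrt (dot v v))^-1 *: v) = 1.
  move=> vv; rewrite dotZl dotZr mulrA -expr2 exprVn sqr_sqrtr ?ltW //.
  by rewrite mulVf ?gt_eqF.
set u1 := (Num.sqrt (dot u u))^-1 *: u in normalize *.
have [eta eta_gt0 Heta] : exists2 e, 0 < e & forall v, v \in s -> e <= dot u1 v.
  apply: seq_pos_bound => v sv.
  by rewrite dotZl mulr_gt0 ?us // invr_gt0 sqrtr_gt0.
have [a a_ge0 Ha] := seq_bound s (fun v => \sum_i `|v i 0|).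
have {}Ha v i : v \in s -> `|v i 0| <= a.
  move=> /Ha; apply: le_trans; rewrite (bigD1 i) //= lerDl.
  by rewrite sumr_ge0.
pose N := (Num.bound (15 * d%:R ^+ 2 * a / eta)).+1.
have N_large : 15 * d%:R ^+ 2 * a <= N%:R * eta.
  rewrite -ler_pdivrMr // ltW // (lt_le_trans (archi_boundP _)) ?ler_nat //.
  by rewrite divr_ge0 ?(ltW eta_gt0) // !mulr_ge0 // exprn_ge0.
(* A bound for the squared length of [A *m v], independent of [z]. *)
pose K := (d%:R * (3 * N%:R * (3 * N%:R))) ^+ 2 * (d%:R * (a * a)) : R.
have K_ge0 : 0 <= K by rewrite /K !mulr_ge0 ?exprn_ge0.
exists ((K / eta + 1) ^+ 2) => z z_large.
pose r := Num.sqrt (dot z z).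
have Keta : 0 < K / eta + 1.
  by rewrite ltr_wpDl // divr_ge0 // ltW.
have r_large : K / eta + 1 <= r.
  by rewrite -(ger0_norm (ltW Keta)) -sqrtr_sqr ler_wsqrtr.
have r_gt0 : 0 < r by lra.
have zz_gt0 : 0 < dot z z by rewrite -sqrtr_gt0.
pose p := r^-1 *: z; have p1 : dot p p = 1 by apply: normalize.
have zE : z = r *: p by rewrite scalerA divff ?gt_eqF // scale1r.
(* The sign keeps [u1 + sg *: p] away from zero, so that rounding a multiple of it is harmless; the
   same sign in front of the reflection restores the direction of [z]. *)
have [sg [sg1 up2]] : exists sg : R, sg ^+ 2 = 1 /\
    2 <= dot (u1 + sg *: p) (u1 + sg *: p).
  have u11 := normalize u uu_gt0.
  have [up_ge0|up_lt0] := leP 0 (dot u1 p).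
    exists 1; rewrite expr1n; split=> //.
    by rewrite scale1r !(dotDl, dotDr) p1 u11 (dotC p); lra.
  exists (-1); rewrite sqrrN expr1n; split=> //.
  by rewrite scaleN1r !(dotDl, dotDr, dotNl, dotNr) p1 u11 (dotC p); lra.
have sp1 : dot (sg *: p) (sg *: p) = 1.
  by rewrite dotZl dotZr p1 mulr1 -expr2.
have [w [w_int wb Hw]] :=
  rounded_reflection (normalize u uu_gt0) sp1 up2 eta_gt0 a_ge0 N_large isT.
have sg_int : sg \is a Num.int.
  by move/eqP: sg1; rewrite sqrf_eq1 => /orP[]/eqP->; rewrite ?rpredN rpred1.
have gramA : (sg *: scaled_reflection w)^T *m (sg *: scaled_reflection w) =
    (dot w w ^+ 2)%:M.
  rewrite -scalemxAr linearZ /= -scalemxAl scaled_reflection_gram scalerA.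
  by rewrite -expr2 sg1 scale1r.
have drop v : v \in s ->
    dot z ((sg *: scaled_reflection w) *m v) <= - (r * (N%:R ^+ 2 * eta)).
  move=> sv; rewrite zE -scalemxAl dotZl dotZr -dotZl -mulrN ler_pM2l //.
  by apply: Hw; [move=> i; apply: Ha|apply: Heta].
have N1 : 1 <= N%:R :> R by rewrite ler1n.
have rN : 0 < r * (N%:R ^+ 2 * eta) by rewrite !mulr_gt0 // exprn_gt0 // ltr0n.
exists (sg *: scaled_reflection w), (dot w w); split.
- by rewrite mxOverZ // scaled_reflection_int.
- rewrite dot_gt0 //; apply: contraTneq (drop _ sv0) => ->.
  by rewrite -scalemxAl scaled_reflectionE dot0r scale0r scaler0 subrr scaler0 dot0r
     oppr_ge0 -ltNge.
- exact: gramA.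
(* In the expansion the cross terms contribute at most [- 2 * (r * (N ^ 2 * eta))], and the
   quadratic term at most [K], which is below [r * (N ^ 2 * eta)]. *)
move=> v sv; rewrite dotDl !dotDr (dotC (_ *m v) z).
have -> : dot ((sg *: scaled_reflection w) *m v) ((sg *: scaled_reflection w) *m v) =
    dot w w ^+ 2 * dot v v.
  by rewrite /dot trmx_mul -mulmxA [_^T *m (_ *m v)]mulmxA gramA mul_scalar_mx
     -scalemxAr mxE.
have : dot w w ^+ 2 * dot v v <= K.
  rewrite ler_pM ?sqr_ge0 ?dot_ge0 //.
    rewrite ler_pXn2r ?nnegrE ?dot_ge0 ?mulr_ge0 //.
    by apply: le_trans (ler_norm _) (normr_dot_le _ wb wb); rewrite mulr_ge0.
  by apply: le_trans (ler_norm _) (normr_dot_le _ _ _) => // i; apply: Ha.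
have : K < r * (N%:R ^+ 2 * eta).
  have : K < r * eta by rewrite -ltr_pdivrMr //; lra.
  move/lt_le_trans; apply; rewrite ler_pM2l // ler_peMl ?(ltW eta_gt0) //.
  by rewrite exprn_ege1.
by have := drop v sv; lra.
Qed.

End Descent.

(** * Extreme points *)

Local Open Scope classical_set_scope.
Local Open Scope ring_scope.

Definition AM_free (R : realType) (d : nat) (C : Type) (S : set 'cV[R]_d)
    (s0 : 'cV[R]_d) (chi : 'cV[R]_d -> C) :=
  forall T t0, similar_copy S s0 T t0 -> ~ almost_monochromatic chi T t0.

(** The form in which the absence of AM copies is used: colours propagate to [f s0]. The point [s1]
    ensures that [col] really occurs on the copy. *)
Lemma AM_free_copy (R : realType) (d : nat) (C : eqType) (S : set 'cV[R]_d)
    (s0 s1 : 'cV[R]_d) (chi : 'cV[R]_d -> C) f col :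
  AM_free S s0 chi -> S s0 -> S s1 -> s1 != s0 -> is_similarity f ->
  (forall s, S s -> s != s0 -> chi (f s) = col) -> chi (f s0) = col.
Proof.
move=> free Ss0 Ss1 s10 sim_f mono; apply/eqP/negPn/negP => /eqP ncol.
have /free : similar_copy S s0 (f @` S) (f s0) by exists f.
apply; split; first by exists s0.
- suff mono' x : ((f @` S) `\ f s0)%classic x -> chi x = col.
    by move=> x y /mono' -> /mono' ->.
  move=> [[s Ss <-] /= ne]; apply: mono => //.
  by apply/eqP => ss0; apply: ne; rewrite ss0.
- move=> monoT; apply: ncol; rewrite -(mono _ Ss1 s10).
  by apply: monoT; [exists s0|exists s1].
Qed.

(** By Gordan's alternative, failure would give a nonnegative dependency between the vectors
    [s - s0], that is, [s0] as a convex combination of the other points. *)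
Lemma extreme_separated (R : realType) (d : nat) (S : {fset 'cV[R]_d}) s0 :
  extreme_point [set` S] s0 ->
  exists u, forall s, s \in S -> s != s0 -> 0 < dot u (s - s0).
Proof.
move=> ext; pose r := [seq s <- enum_fset S | s != s0].
have r_uniq : uniq r by rewrite filter_uniq ?fset_uniq.
have [[u Hu]|[c [c_ge0 [i ri ci] csum]]] := gordan (fun s => s - s0) r_uniq.
  by exists u => s sS ss0; apply: Hu; rewrite mem_filter ss0.
case: ext => M [cM SM].
have c_gt0 : 0 < \sum_(s <- r) c s.
  rewrite (big_rem i) //= ltr_wpDr // big_seq sumr_ge0 // => j /mem_rem.
  exact: c_ge0.
have -> : s0 = (\sum_(s <- r) c s)^-1 *: \sum_(s <- r) c s *: s.
  apply: (scalerI (lt0r_neq0 c_gt0)).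
  rewrite scalerA divff ?gt_eqF // scale1r scaler_suml; apply/esym/eqP.
  rewrite -subr_eq0 -sumrB -[X in _ == X]csum; apply/eqP/eq_bigr => s _.
  by rewrite scalerBr.
apply: (convex_set_sum cM) => // s; rewrite mem_filter => /andP[/eqP ss0 sS].
by apply: SM.
Qed.

Section IntegerPoints.
Variables (R : realType) (d : nat).
Implicit Types z : 'cV[R]_d.

Lemma dot_int z : z \is a mxOver Num.int -> dot z z \is a Num.int.
Proof.
by move=> z_int; rewrite dotE rpred_sum // => i _; rewrite rpredM //; apply/mxOverP.
Qed.

Lemma finite_integer_ball (B : R) : exists F : seq 'cV[R]_d,
  forall z, z \is a mxOver Num.int -> dot z z < B -> z \in F.
Proof.
pose M := (Num.bound `|B|).+1.
exists [seq \col_i ((m i)%:R - M%:R) | m : {ffun 'I_d -> 'I_(M + M).+1}] => z z_int zB.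
have zM i : `|z i 0| <= M%:R.
  rewrite -(@ler_pXn2r _ 2) ?nnegrE // -normrX ger0_norm ?sqr_ge0 //.
  rewrite (le_trans (sqr_coord_le_dot z i)) // (le_trans (ltW zB)) //.
  have := ler_norm B; have := archi_boundP (normr_ge0 B).
  have : 1 <= M%:R :> R by rewrite ler1n.
  rewrite /M -natr1; nra.
apply/mapP; exists [ffun i => inord (Num.trunc (z i 0 + M%:R))].
  by rewrite mem_enum.
apply/matrixP => i j; rewrite ord1 !mxE ffunE.
have zi : z i 0 \is a Num.int by apply/mxOverP.
have [zM1 zM2] : - M%:R <= z i 0 /\ z i 0 <= M%:R by apply/andP; rewrite -ler_norml.
have zn : z i 0 + M%:R \is a Num.nat by rewrite natrEint rpredD ?natr_int //=; lra.
rewrite inordK; last first.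
  by rewrite ltnS -(ler_nat R) truncnK // natrD; lra.
by rewrite truncnK // addrK.
Qed.

End IntegerPoints.

(** Squared norms of lattice points are integers, so each strict descent lowers them by at least one
    and induction applies. *)
Lemma int_lt_le (R : realType) (x y : R) :
  x \is a Num.int -> y \is a Num.int -> x < y -> x + 1 <= y.
Proof.
move=> /intrP[m ->] /intrP[n ->]; rewrite ltr_int => mn.
by rewrite -[1]/(1%:~R) -intrD ler_int lezD1.
Qed.

(* A large monochromatic ball of lattice points, provided by Gallai's theorem,
   grows to the whole lattice. *)
Lemma extreme_not_AP_free (R : realType) (d : nat) (C : finType)
    (S : {fset 'cV[R]_d}) (s0 s1 : 'cV[R]_d) (chi : 'cV[R]_d -> C) :
  (0 < d)%N -> (forall x, x \in S -> x \is a mxOver Num.int) ->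
  s0 \in S -> s1 \in S -> s1 != s0 -> extreme_point [set` S] s0 ->
  AM_free [set` S] s0 chi -> ~ AP_free chi.
Proof.
move=> d_gt0 S_int Ss0 Ss1 s10 /extreme_separated[u Hu] free apfree.
pose r := [seq s - s0 | s <- enum_fset S & s != s0].
have rP s : s \in S -> s != s0 -> s - s0 \in r.
  by move=> sS ss0; apply/map_f; rewrite mem_filter ss0.
have [B HB] : exists B : R, forall z, B <= dot z z ->
    exists (A : 'M[R]_d) (mu : R), [/\ A \is a mxOver Num.int, 0 < mu,
      A^T *m A = (mu ^+ 2)%:M &
      forall v, v \in r -> dot (z + A *m v) (z + A *m v) < dot z z].
  apply: (sphere_descent (u := u) (rP _ Ss1 s10)) => v /mapP[s].
  by rewrite mem_filter => /andP[ss0 sS] ->; apply: Hu.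
have [F HF] := finite_integer_ball d B.
have [c [t [t_gt0 [col Hcol]]]] := gallai F chi.
have t0 : 0 < t%:R :> R by rewrite ltr0n.
have lattice z : z \is a mxOver Num.int -> chi (c + t%:R *: z) = col.
  move=> z_int; have [n] : exists n : nat, dot z z < n%:R.
    by exists (Num.bound (dot z z)); apply/archi_boundP/dot_ge0.
  elim: n z z_int => [|n IHn] z z_int zn.
    by have := dot_ge0 z; rewrite leNgt zn.
  have [zB|Bz] := ltP (dot z z) B.
    by rewrite scaler_nat Hcol ?HF.
  have [A [mu [A_int mu_gt0 gramA descent]]] := HB z Bz.
  (* The ratio is [t * mu] and [mu^-1 *: A] is orthogonal; the translation is chosen to send [s0] to
     the lattice point awaiting its colour. *)
  pose f x := (t%:R * mu) *: ((mu^-1 *: A) *m x) + (c + t%:R *: (z - A *m s0)).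
  have fE x : f x = c + t%:R *: (z + A *m (x - s0)).
    rewrite /f -scalemxAl scalerA mulfK ?gt_eqF // addrCA -scalerDr mulmxBr.
    by rewrite addrCA.
  have sim_f : is_similarity f.
    exists (t%:R * mu), (mu^-1 *: A), (c + t%:R *: (z - A *m s0)); split=> //.
      by rewrite mulr_gt0.
    rewrite -scalemxAr linearZ /= -scalemxAl gramA !scale_scalar_mx.
    by rewrite expr2 mulKf ?gt_eqF // mulVf ?gt_eqF.
  have <- : f s0 = c + t%:R *: z by rewrite fE subrr mulmx0 addr0.
  apply: (AM_free_copy (s1 := s1) free) => // s sS ss0; rewrite fE.
  have zs_int : z + A *m (s - s0) \is a mxOver Num.int.
    have: A *m (s - s0) \is a mxOver Num.int.
      apply: mxOverM => //; apply/mxOverP => i j.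
      by rewrite mxE [X in _ + X]mxE rpredB //; apply/mxOverP; apply: S_int.
    move=> As_int; apply/mxOverP => i j.
    by rewrite mxE rpredD //; apply/mxOverP.
  apply: IHn => //.
  have := int_lt_le (dot_int zs_int) (dot_int z_int) (descent _ (rP _ sS ss0)).
  by move: zn; rewrite -natr1; lra.
pose v : 'cV[R]_d := t%:R *: const_mx 1.
have mono m : chi (c + m%:R *: v) = col.
  rewrite /v scalerA mulrC -scalerA lattice //; apply/mxOverP => i j.
  by rewrite !mxE mulr1.
apply: (apfree (range (fun m : nat => c + m%:R *: v))).
  exists c, v; split=> //; apply/eqP => /matrixP/(_ (Ordinal d_gt0) 0).
  by rewrite !mxE mulr1 => /eqP; rewrite gt_eqF.
by move=> _ _ [m _ <-] [n _ <-]; rewrite !mono.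
Qed.

(** * Three points *)

Lemma conv_hull_sub (R : realType) (d : nat) (A M : set 'cV[R]_d) :
  @convex_set R 'cV[R]_d M -> A `<=` M -> conv_hull A `<=` M.
Proof. by move=> cM AM x; apply; split. Qed.

Lemma three_points_not_AP_free (R : realType) (d : nat) (C : finType)
    (S : {fset 'cV[R]_d}) (s0 : 'cV[R]_d) (chi : 'cV[R]_d -> C) :
  (forall x, x \in S -> x \is a mxOver Num.int) -> #|` S| = 3 ->
  s0 \in S -> ~ extreme_point [set` S] s0 ->
  AM_free [set` S] s0 chi -> ~ AP_free chi.
Proof.
move=> S_int S3 Ss0 /contrapT next free apfree.
have [a [b [aS bS as0 bs0 [ab Sab]]]] : exists a b,
    [/\ a \in S, b \in S, a != s0, b != s0 & a != b /\
        forall s, s \in S -> s != s0 -> s = a \/ s = b].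
  have card2 : size (enum_fset (S `\ s0)%fset) = 2.
    by have : #|` (S `\ s0)%fset| = 2 by have := cardfsD1 s0 S; rewrite Ss0 S3; lia.
  have memE x : (x \in enum_fset (S `\ s0)%fset) = (x != s0) && (x \in S).
    by rewrite -in_fsetD1.
  have := fset_uniq (S `\ s0)%fset.
  case: (enum_fset (S `\ s0)%fset) card2 memE => [|a [|b []]] //= _ memE.
  rewrite inE andbT => ab; exists a, b.
  have /andP[as0 aS] : (a != s0) && (a \in S) by rewrite -memE !inE eqxx.
  have /andP[bs0 bS] : (b != s0) && (b \in S) by rewrite -memE !inE eqxx orbT.
  split=> //; split=> // s sS ss0.
  have : s \in [:: a; b] by rewrite memE ss0.
  by rewrite !inE => /orP[]/eqP; [left|right].
have [th [th0 th1 s0E]] : exists th : R,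
    [/\ 0 <= th, th <= 1 & s0 = th *: a + (1 - th) *: b].
  pose M : set 'cV[R]_d := fun x => exists th : R,
    [/\ 0 <= th, th <= 1 & x = th *: a + (1 - th) *: b].
  apply: (conv_hull_sub (M := M) _ _ next).
    apply/convex_setP => x y l [t1 [t10 t11 ->]] [t2 [t20 t21 ->]] l0 l1.
    exists (l * t1 + (1 - l) * t2); split; [nra|nra|].
    rewrite !scalerDr !scalerA addrACA -!scalerDl; congr (_ + _ *: _); ring.
  move=> s [/= sS /eqP ss0]; have [->|->] := Sab s sS ss0.
    by exists 1; rewrite subrr scale0r addr0 scale1r.
  by exists 0; rewrite subr0 scale0r add0r scale1r.
have {}th0 : 0 < th.
  rewrite lt_neqAle th0 andbT; apply: contraNneq bs0 => t0.
  by rewrite s0E -t0 subr0 scale0r add0r scale1r.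
have {}th1 : th < 1.
  rewrite lt_neqAle th1 andbT; apply: contraNneq as0 => t1.
  by rewrite s0E t1 subrr scale0r addr0 scale1r.
(* A coordinate separating [a] from [b] clears denominators: [th * D] and [(1 - th) * D] are
   integers, so [s0] divides the segment in an integral ratio. *)
have [j abj] : exists j, a j 0 != b j 0.
  apply/existsP; rewrite -negb_forall; apply: contraNN ab => /forallP ab.
  by apply/eqP/matrixP => i k; rewrite ord1; apply/eqP.
pose D := `|a j 0 - b j 0|.
have D_gt0 : 0 < D by rewrite normr_gt0 subr_eq0.
have entry x : x \in S -> x j 0 \is a Num.int by move=> /S_int /mxOverP.
have thD : th * D \is a Num.nat.
  rewrite natrEint mulr_ge0 ?ltW // andbT /D -(gtr0_norm th0) -normrM.
  have -> : th * (a j 0 - b j 0) = s0 j 0 - b j 0.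
    by rewrite [in RHS]s0E !mxE; ring.
  have: `|s0 j 0 - b j 0| \is a Num.nat by rewrite natr_norm_int ?rpredB ?entry.
  by rewrite natrEint => /andP[].
have th'D : (1 - th) * D \is a Num.nat.
  rewrite natrEint mulr_ge0 ?subr_ge0 ?ltW // andbT mulrBl mul1r rpredB //.
    have: D \is a Num.nat by rewrite natr_norm_int ?rpredB ?entry.
    by rewrite natrEint => /andP[].
  by move: thD; rewrite natrEint => /andP[].
move/natrP: thD => [p pE]; move/natrP: th'D => [q qE].
have p_gt0 : (0 < p)%N by rewrite -(ltr0n R) -pE mulr_gt0.
have q_gt0 : (0 < q)%N by rewrite -(ltr0n R) -qE mulr_gt0 // subr_gt0.
have pqE : (p + q)%:R = D by rewrite natrD -pE -qE; ring.
pose g (m : nat) := chi (m%:R *: (a - b)).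
have [y k k_gt0 gyk|m0 [v [v_gt0 mono]]] := three_point_AP (g := g) p_gt0 q_gt0.
  (* The homothety taking [b], [s0], [a] to the positions [y], [y + p * k], [y + (p + q) * k] on the
     line carrying [g]. *)
  pose f x := ((p + q) * k)%:R *: (1%:M *m x) +
    (y%:R *: (a - b) - ((p + q) * k)%:R *: b).
  have fE x : f x = y%:R *: (a - b) + ((p + q) * k)%:R *: (x - b).
    by rewrite /f mul1mx addrCA -scalerBr.
  have sim_f : is_similarity f.
    exists ((p + q) * k)%:R, 1%:M, (y%:R *: (a - b) - ((p + q) * k)%:R *: b).
    split=> //; last by rewrite trmx1 mulmx1.
    by rewrite ltr0n muln_gt0 addn_gt0 p_gt0.
  have fs0 : f s0 = (y + p * k)%:R *: (a - b).
    rewrite fE natrD scalerDl; congr (_ + _).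
    have -> : s0 - b = th *: (a - b).
      by rewrite [in LHS]s0E scalerBl scale1r scalerBr addrA addrAC addrK.
    by rewrite scalerA !natrM pqE -pE; congr (_ *: _); ring.
  rewrite /g -fs0; apply: (AM_free_copy (s1 := a) free) => // s sS ss0.
  have [->|->] := Sab s sS ss0.
    rewrite fE -scalerDl -natrD; exact: esym gyk.
  by rewrite fE subrr scaler0 addr0.
apply: (apfree (range (fun m : nat =>
  m0%:R *: (a - b) + m%:R *: (v%:R *: (a - b))))).
  exists (m0%:R *: (a - b)), (v%:R *: (a - b)); split=> //.
  by rewrite scaler_eq0 negb_or pnatr_eq0 -lt0n v_gt0 subr_eq0.
suff mono' m : chi (m0%:R *: (a - b) + m%:R *: (v%:R *: (a - b))) = g m0.
  by move=> _ _ [m _ <-] [n _ <-]; rewrite !mono'.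
by rewrite scalerA -scalerDl -natrM -natrD mulnC -(mono m).
Qed.

(** * The colouring by shells and cells *)

Lemma dot_le_sq (R : realFieldType) (d : nat) (x : 'cV[R]_d) (a : R) :
  0 <= a -> (forall j, `|x j 0| <= a) -> dot x x <= d%:R * a ^+ 2.
Proof.
by move=> a0 xa; rewrite (le_trans (ler_norm _)) ?expr2 ?normr_dot_le.
Qed.

Section ShellColouring.
Variables (R : realType) (d : nat).
Implicit Types (x y z : 'cV[R]_d).

(* Half-open, so that each of the boxes bounding a shell is a union of cells. *)
Definition inbox i x := [forall j, (- 2 ^+ i <= x j 0) && (x j 0 < 2 ^+ i)].

Lemma inboxP i x :
  reflect (forall j, - 2 ^+ i <= x j 0 /\ x j 0 < 2 ^+ i) (inbox i x).
Proof. by apply: (iffP forallP) => H j; apply/andP/H. Qed.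

Lemma inbox_norm i x j : inbox i x -> `|x j 0| <= 2 ^+ i.
Proof. by move=> /inboxP/(_ j)[x1 x2]; rewrite ler_norml x1 ltW. Qed.

Lemma inbox_monotone i i' x : (i <= i')%N -> inbox i x -> inbox i' x.
Proof.
move=> ii' /inboxP xi; apply/inboxP => j; have [x1 x2] := xi j.
have le2 : 2 ^+ i <= 2 ^+ i' :> R by rewrite ler_weXn2l // ler1n.
by split; [apply: le_trans x1; rewrite lerN2|apply: lt_le_trans le2].
Qed.

Lemma inbox_ex x : exists i, inbox i x.
Proof.
pose n j := Num.bound `|x j 0|.
exists (\max_j n j)%N; apply/inboxP => j.
have : `|x j 0| < 2 ^+ (\max_j n j)%N.
  by apply: upper_nthrootP; apply: (leq_bigmax (F := n) j).
by rewrite ltr_norml => /andP[/ltW].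
Qed.

Definition shell x := ex_minn (inbox_ex x).

Lemma inbox_shell x : inbox (shell x) x.
Proof. by rewrite /shell; case: ex_minnP. Qed.

Lemma shell_leq i x : inbox i x -> (shell x <= i)%N.
Proof. by rewrite /shell; case: ex_minnP => m _; apply. Qed.

Lemma shell_norm x : (0 < shell x)%N -> exists j, 2 ^+ shell x <= 2 * `|x j 0|.
Proof.
move=> x0; apply/not_existsP => H.
suff /shell_leq : inbox (shell x).-1 x by lia.
apply/inboxP => j; have := H j; move/negP; rewrite -ltNge -{1}(prednK x0) exprS.
by rewrite ltr_pM2l // ltr_norml => /andP[/ltW].
Qed.

(* The box [inbox i] is cut into [(4 * N) ^ d] cells of side [2 ^ i / (2 * N)]. *)
Definition cell_coord N i x j : R := (N + N)%:R * (x j 0 / 2 ^+ i + 1).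

Definition cell N x j : nat := Num.trunc (cell_coord N (shell x) x j).

Lemma cell_coord_bounds N x j : (0 < N)%N ->
  0 <= cell_coord N (shell x) x j < (N + N + (N + N))%:R.
Proof.
move=> N0; have /inboxP/(_ j)[x1 x2] := inbox_shell x.
have p0 : 0 < 2 ^+ shell x :> R by rewrite exprn_gt0.
have NN : 0 < (N + N)%:R :> R by rewrite ltr0n addn_gt0 N0.
have NN2 : (N + N + (N + N))%:R = (N + N)%:R * 2 :> R.
  by rewrite (natrD _ (N + N)); ring.
apply/andP; split.
  by rewrite mulr_ge0 ?(ltW NN) // -lerBlDr sub0r ler_pdivlMr // mulN1r.
rewrite NN2 ltr_pM2l // -[2]/(1 + 1) ltrD2r.
by rewrite ltr_pdivrMr // mul1r.
Qed.

Lemma cell_itv N x j : (0 < N)%N ->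
  (cell N x j)%:R <= cell_coord N (shell x) x j < (cell N x j).+1%:R.
Proof. by move=> N0; apply/truncn_itv; have /andP[] := cell_coord_bounds x j N0. Qed.

(** For [0 < N] the cell indices stay below [4 * N], so no [inord] falls back to its default
    value. *)
Definition shell_colour N m x : 'I_m.+1 * {ffun 'I_d -> 'I_(N + N + (N + N)).+1} :=
  (inord (shell x %% m.+1), [ffun j => inord (cell N x j)]).

Lemma shell_colour_eq N m x y : (0 < N)%N ->
  (shell_colour N m x = shell_colour N m y) <->
  (shell x = shell y %[mod m.+1] /\ forall j, cell N x j = cell N y j).
Proof.
move=> N0; have cellN z j : (cell N z j < (N + N + (N + N)).+1)%N.
  have /andP[_ lt1] := cell_coord_bounds z j N0.
  have /andP[le2 _] := cell_itv z j N0.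
  by rewrite ltnW // ltnS -(ltr_nat R) (le_lt_trans le2).
split=> [[e1 e2]|[e1 e2]].
  split.
    by have := congr1 (@nat_of_ord _) e1; rewrite !inordK ?ltn_pmod.
  move=> j; have := congr1 (fun g : {ffun _ -> _} => nat_of_ord (g j)) e2.
  by rewrite !ffunE !inordK.
by rewrite /shell_colour e1; congr (_, _); apply/ffunP => j; rewrite !ffunE e2.
Qed.

(** The grid of the shell of [x] is applied to [y] whatever the shell of [y]; this makes the cell a
    product of intervals, hence convex. *)
Definition same_cell N x : set 'cV[R]_d := fun y =>
  forall j, (cell N x j)%:R <= cell_coord N (shell x) y j < (cell N x j).+1%:R.

Lemma same_cellxx N x : (0 < N)%N -> same_cell N x x.
Proof. by move=> N0 j; apply: cell_itv. Qed.

(** In the coordinates of the grid the outer box is bounded by 0 and [4 * N], the next smaller box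
    by [N] and [3 * N]. These are integers, so a cell lies entirely inside or entirely outside each
    box. *)
Lemma same_cell_shell N x y : (0 < N)%N -> same_cell N x y -> shell y = shell x.
Proof.
move=> N0 xy; pose s := shell x.
have p0 i : 0 < 2 ^+ i :> R by rewrite exprn_gt0.
have NN : 0 < (N + N)%:R :> R by rewrite ltr0n addn_gt0 N0.
have NN2 : (N + N + (N + N))%:R = (N + N)%:R * 2 :> R.
  by rewrite (natrD _ (N + N)); ring.
have nat_le (n : nat) z j : same_cell N x z ->
    (n%:R <= cell_coord N s z j) = (n <= cell N x j)%N.
  move=> /(_ j)/andP[z1 z2]; apply/idP/idP => [nz|nc].
    by rewrite -ltnS -(ltr_nat R) (le_lt_trans nz).
  by rewrite (le_trans _ z1) // ler_nat.
have box0 z : inbox s z = [forall j, (0%:R <= cell_coord N s z j) &&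
    ~~ ((N + N + (N + N))%:R <= cell_coord N s z j)].
  apply: eq_forallb => j; rewrite -ltNge /cell_coord.
  rewrite pmulr_rge0 // -lerBlDr sub0r ler_pdivlMr // mulN1r.
  rewrite NN2 ltr_pM2l // -[2]/(1 + 1) ltrD2r.
  by rewrite ltr_pdivrMr // mul1r.
have box1 z : (0 < s)%N -> inbox s.-1 z = [forall j, (N%:R <= cell_coord N s z j) &&
    ~~ ((N + N + N)%:R <= cell_coord N s z j)].
  move=> s0; apply: eq_forallb => j; rewrite -ltNge /cell_coord.
  have e : 2 ^+ s = 2 * 2 ^+ s.-1 :> R by rewrite -exprS prednK.
  have p1 := p0 s.-1; rewrite e.
  have -> : (N + N)%:R * (z j 0 / (2 * 2 ^+ s.-1) + 1) =
            N%:R * (z j 0 / 2 ^+ s.-1 + 2).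
    move: p1; rewrite natrD; move: (2 ^+ s.-1) (z j 0) N%:R => P t n P0.
    by field; rewrite gt_eqF.
  have N0' : 0 < N%:R :> R by rewrite ltr0n.
  have -> : (N + N + N)%:R = N%:R * 3 :> R by rewrite !natrD; ring.
  rewrite -{1}[N%:R]mulr1 ler_pM2l //.
  rewrite ltr_pM2l //; congr (_ && _).
    by rewrite -lerBlDr (_ : 1 - 2 = -1) ?ler_pdivlMr ?mulN1r //; ring.
  by rewrite -ltrBrDr (_ : 3 - 2 = 1) ?ltr_pdivrMr ?mul1r //; ring.
have xx := same_cellxx x N0.
have eqb n j : (n%:R <= cell_coord N s y j) = (n%:R <= cell_coord N s x j).
  by rewrite !nat_le.
have ys : inbox s y.
  have := inbox_shell x; rewrite -/s !box0.
  by under eq_forallb do rewrite -!eqb.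
apply/eqP; rewrite eqn_leq shell_leq //= leqNgt; apply/negP => lt_s.
have s0 : (0 < s)%N by apply: leq_ltn_trans lt_s.
have : inbox s.-1 y.
  by apply: inbox_monotone (inbox_shell y); rewrite -ltnS prednK.
rewrite box1 //; under eq_forallb do rewrite !eqb.
by rewrite -box1 // => /shell_leq; rewrite -/s; lia.
Qed.

Lemma same_cell_colour N m x y : (0 < N)%N -> same_cell N x y ->
  shell_colour N m y = shell_colour N m x.
Proof.
move=> N0 xy; have e := same_cell_shell N0 xy.
apply/shell_colour_eq => //; split=> [|j]; first by rewrite e.
by rewrite /cell e; apply/truncn_def/xy.
Qed.

Lemma same_cellP N m x y : (0 < N)%N -> shell x = shell y ->
  shell_colour N m x = shell_colour N m y -> same_cell N x y.
Proof.
move=> N0 e /shell_colour_eq[//|_ ec] j.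
by rewrite ec e; apply: cell_itv.
Qed.

Lemma convex_same_cell N x : @convex_set R 'cV[R]_d (same_cell N x).
Proof.
apply/convex_setP => y z l xy xz l0 l1 j.
have := xy j; have := xz j; rewrite /cell_coord !mxE.
have -> : (N + N)%:R * ((l * y j 0 + (1 - l) * z j 0) / 2 ^+ shell x + 1) =
    l * ((N + N)%:R * (y j 0 / 2 ^+ shell x + 1)) +
    (1 - l) * ((N + N)%:R * (z j 0 / 2 ^+ shell x + 1)).
  have : 2 ^+ shell x != 0 :> R by rewrite expf_neq0.
  move: (2 ^+ shell x) (y j 0) (z j 0) (N + N)%:R => P t t' n P0.
  by field.
move: ((N + N)%:R * (y j 0 / _ + 1)) ((N + N)%:R * (z j 0 / _ + 1)) => u v.
move: (cell N x j)%:R (cell N x j).+1%:R => b c /andP[v1 v2] /andP[u1 u2].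
apply/andP; split; first by nra.
have [->|l0'] := eqVneq l 0; first by lra.
have l2 : 0 < l by rewrite lt_neqAle eq_sym l0'.
nra.
Qed.

Lemma same_cell_near N x y : (0 < N)%N -> same_cell N x y ->
  dot (x - y) (x - y) <= d%:R * (2 ^+ shell x / N%:R) ^+ 2.
Proof.
move=> N0 xy; have p0 : 0 < 2 ^+ shell x :> R by rewrite exprn_gt0.
have N0' : 0 < N%:R :> R by rewrite ltr0n.
apply: dot_le_sq => [|j]; first by rewrite divr_ge0 ?ltW.
have /andP[y1 y2] := xy j; have /andP[x1 x2] := cell_itv x j N0.
have : `|cell_coord N (shell x) x j - cell_coord N (shell x) y j| <= 1.
  move: x1 x2 y1 y2; rewrite -natr1 ler_norml; clear.
  by move: (cell_coord _ _ x j) (cell_coord _ _ y j) (cell N x j)%:R => s t c; lra.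
have -> : cell_coord N (shell x) x j - cell_coord N (shell x) y j =
    2 * N%:R / 2 ^+ shell x * (x - y) j 0.
  move: p0; rewrite /cell_coord !mxE natrD.
  move: (2 ^+ shell x) (x j 0) (y j 0) N%:R => P t t' n P0.
  by field; rewrite gt_eqF.
rewrite normrM gtr0_norm ?divr_gt0 ?mulr_gt0 // => h.
rewrite ler_pdivlMr // mulrC.
move: h; rewrite mulrAC ler_pdivrMr // mul1r.
have := mulr_ge0 (ltW N0') (normr_ge0 ((x - y) j 0)); rewrite -mulrA.
by move: (2 ^+ shell x) (N%:R * _) => P t; clear; lra.
Qed.

Lemma distinct_shells m x y : shell x = shell y %[mod m.+1] ->
  (shell x < shell y)%N -> (shell x + m < shell y)%N.
Proof.
move=> exy lt; have : (m.+1 %| shell y - shell x)%N.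
  by rewrite -eqn_mod_dvd ?(ltnW lt) //; apply/eqP.
by move/dvdn_leq; rewrite subn_gt0 => /(_ lt); lia.
Qed.

(** Some coordinate of [y] is at least half of [2 ^+ shell y], while those of [x] are at most a
    quarter of it. *)
Lemma distinct_shells_far x y : (shell x + 1 < shell y)%N ->
  (2 ^+ shell y / 4) ^+ 2 <= dot (y - x) (y - x).
Proof.
move=> lt; have [|j yj] := @shell_norm y; first by lia.
have xj := inbox_norm j (inbox_shell x).
have xy : 2 ^+ shell x * 4 <= 2 ^+ shell y :> R.
  have -> : 4 = 2 ^+ 2 :> R by rewrite expr2; ring.
  by rewrite -exprD ler_weXn2l ?ler1n //; lia.
have P0 : 0 <= 2 ^+ shell y :> R by rewrite exprn_ge0.
apply: le_trans (sqr_coord_le_dot (y - x) j).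
rewrite -[leRHS]ger0_norm ?sqr_ge0 // normrX ler_pXn2r ?nnegrE ?divr_ge0 //.
have := lerB_dist (y j 0) (x j 0); rewrite !mxE.
rewrite ler_pdivrMr //; move: xj yj xy P0.
by move: (2 ^+ shell x) (2 ^+ shell y) => P Q; lra.
Qed.

Lemma low_shells_near m k x y :
  (shell x + m < k)%N -> (shell y + m < k)%N ->
  dot (x - y) (x - y) <= d%:R * (2 ^+ k / 2 ^+ m) ^+ 2.
Proof.
have half z : (shell z + m < k)%N -> 2 ^+ shell z * 2 <= 2 ^+ k / 2 ^+ m :> R.
  move=> zk; rewrite ler_pdivlMr ?exprn_gt0 // -exprSr -exprD.
  by rewrite ler_weXn2l ?ler1n.
move=> /half hx /half hy; apply: dot_le_sq => [|j].
  by rewrite divr_ge0 // exprn_ge0.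
have := inbox_norm j (inbox_shell x); have := inbox_norm j (inbox_shell y).
have := ler_normB (x j 0) (y j 0); rewrite !mxE.
by move: (2 ^+ k / 2 ^+ m) (2 ^+ shell x) (2 ^+ shell y) hx hy => P Q S; lra.
Qed.

(** Here [P] is the size of the larger shell and [K] is [N] for points of one cell, [2 ^+ m] for
    points of much lower shells; the 16 is the square of the 4 in the far distance. *)
Lemma small_lt_big (e P K b B : R) : 0 <= e -> 0 < P -> 0 < K ->
  16 * d%:R * e < K ^+ 2 -> b <= d%:R * (P / K) ^+ 2 -> (P / 4) ^+ 2 <= B ->
  e * b < B.
Proof.
move=> e0 P0 K0 eK bK BP; apply: lt_le_trans BP.
have /le_lt_trans : e * b <= e * (d%:R * (P / K) ^+ 2) by apply: ler_wpM2l.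
have e16 : 4 ^+ 2 = 16 :> R by ring.
apply; rewrite !expr_div_n e16 !mulrA ltr_pdivrMr ?exprn_gt0 //.
have P20 : 0 < P ^+ 2 by rewrite exprn_gt0.
have : P ^+ 2 * (16 * d%:R * e) < P ^+ 2 * K ^+ 2 by rewrite ltr_pM2l.
by move: (K ^+ 2) => Q; rewrite expr2; lra.
Qed.

(* Two points of the same colour are either very close or very far apart relative
   to the larger shell, so three of them outside a common shell cannot span
   distances of bounded ratio. *)
Lemma three_same_colour (e : R) N m x y z :
  (0 < N)%N -> (0 < m)%N -> 0 <= e ->
  16 * d%:R * e < N%:R ^+ 2 -> 16 * d%:R * e < (2 ^+ m) ^+ 2 ->
  shell_colour N m x = shell_colour N m y ->
  shell_colour N m z = shell_colour N m y -> (shell x < shell y)%N ->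
  [\/ e * dot (x - y) (x - y) < dot (z - y) (z - y),
      e * dot (z - y) (z - y) < dot (y - x) (y - x) |
      e * dot (z - x) (z - x) < dot (y - x) (y - x)].
Proof.
move=> N0 m0 e0 eN em exy ezy lt.
have p0 i : 0 < 2 ^+ i :> R by rewrite exprn_gt0.
have N0' : 0 < N%:R :> R by rewrite ltr0n.
have [mxy _] := (shell_colour_eq m x y N0).1 exy.
have [mzy _] := (shell_colour_eq m z y N0).1 ezy.
have farxy := distinct_shells mxy lt.
(* In each case the close pair is the one in the two lower shells, or in the common cell if [z]
   shares the shell of [y]; the third point is far away. *)
have [zy|yz|zy] := ltngtP (shell z) (shell y).
- have farzy := distinct_shells mzy zy.
  apply: Or33; apply: small_lt_big (low_shells_near farzy farxy) _ => //.
  by apply: distinct_shells_far; lia.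
- have farzy := distinct_shells (esym mzy) yz.
  apply: Or31; apply: small_lt_big (@low_shells_near m (shell z) _ _ _ _) _ => //.
    by lia.
  by apply: distinct_shells_far; lia.
apply: Or32; have near := same_cell_near N0 (same_cellP N0 zy ezy).
apply: small_lt_big near _ => //; rewrite zy.
by apply: distinct_shells_far; lia.
Qed.

End ShellColouring.

(** * Progressions and almost-monochromatic copies under the shell colouring *)

Section Construction.
Variables (R : realType) (d N m : nat) (e : R).
Hypotheses (N0 : (0 < N)%N) (m0 : (0 < m)%N) (e5 : 5 <= e).
Hypothesis eN : 16 * d%:R * e < N%:R ^+ 2.
Hypothesis em : 16 * d%:R * e < (2 ^+ m) ^+ 2.
Implicit Types x y z : 'cV[R]_d.

Let e_ge0 : 0 <= e. Proof. exact: le_trans (ler0n _ 5) e5. Qed.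

Lemma shell_colour_AP_free : AP_free (@shell_colour R d N m).
Proof.
move=> A [a [v [v_neq0 AE]]] mono.
pose x n := a + n%:R *: v.
have vv : 0 < dot v v by apply: dot_gt0.
have col n n' : shell_colour N m (x n) = shell_colour N m (x n').
  by apply: mono; rewrite AE; [exists n|exists n'].
have dist n n' k : (n' + k = n)%N ->
    dot (x n - x n') (x n - x n') = k%:R ^+ 2 * dot v v /\
    dot (x n' - x n) (x n' - x n) = k%:R ^+ 2 * dot v v.
  move=> <-; have e1 : x (n' + k)%N - x n' = k%:R *: v.
    by apply/eqP; rewrite subr_eq /x natrD scalerDl addrA addrC.
  rewrite -[x n' - _]opprB e1.
  by rewrite !(dotNl, dotNr, dotZl, dotZr); split; ring.
(* Among three consecutive terms the squared distances are 1 or 4 times [dot v v], a ratio below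
   [e], so neighbouring terms cannot lie in different shells. *)
have shellS n : shell (x n.+1) = shell (x n).
  have [d1 d1'] := dist _ _ _ (addn1 n).
  have [d2 d2'] := dist _ _ _ (addn1 n.+1).
  have [d3 d3'] := dist _ _ _ (addn2 n).
  have four : 2%:R ^+ 2 = 4 :> R by ring.
  have e5v : 5 * dot v v <= e * dot v v by rewrite ler_pM2r.
  rewrite ?expr1n ?mul1r ?four in d1 d1' d2 d2' d3 d3'.
  case: (ltngtP (shell (x n.+1)) (shell (x n))) => // lt; exfalso.
    by have [] := three_same_colour N0 m0 e_ge0 eN em (col _ _) (col n.+2 _) lt;
      rewrite ?(d1, d1', d2, d2', d3, d3'); lra.
  by have [] := three_same_colour N0 m0 e_ge0 eN em (col _ _) (col n.+2 _) lt;
    rewrite ?(d1, d1', d2, d2', d3, d3'); lra.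
have shellE n : shell (x n) = shell a.
  by elim: n => [|n]; rewrite ?shellS // /x scale0r addr0.
have [j vj] : exists j, v j 0 != 0.
  apply/existsP; rewrite -negb_forall; apply: contraNN v_neq0 => /forallP v0.
  by apply/eqP/matrixP => i k; rewrite ord1 mxE; apply/eqP.
have vj0 : 0 < `|v j 0| by rewrite normr_gt0.
pose P : R := 2 ^+ shell a; have P0 : 0 <= P by rewrite exprn_ge0.
(* A constant shell confines the progression to one box of width [P + P]; this many steps leave
   it. *)
pose n := Num.bound ((P + P) / `|v j 0|).
have : P + P < n%:R * `|v j 0|.
  by rewrite -ltr_pdivrMr // archi_boundP // divr_ge0 ?addr_ge0.
have := inbox_norm j (inbox_shell a); have := inbox_norm j (inbox_shell (x n)).
rewrite shellE !mxE -/P => h1 h2; apply/negP; rewrite -leNgt.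
have := ler_normB (a j 0 + n%:R * v j 0) (a j 0).
by rewrite addrAC subrr add0r normrM normr_nat; lra.
Qed.

Lemma shell_colour_AM_free (S : {fset 'cV[R]_d}) (s0 : 'cV[R]_d) :
  (forall s t u w, s \in S -> t \in S -> u \in S -> w \in S -> u != w ->
     dot (s - t) (s - t) <= e * dot (u - w) (u - w)) ->
  (3 < #|` S|)%N -> s0 \in S -> conv_hull ([set` S] `\ s0) s0 ->
  AM_free [set` S] s0 (@shell_colour R d N m).
Proof.
move=> He S3 Ss0 hull _ _ [f [[la [Q [c [la_gt0 QQ fE]]]] -> ->]] [_ mono nmono].
have dist s t : dot (f s - f t) (f s - f t) = la ^+ 2 * dot (s - t) (s - t).
  have -> : f s - f t = la *: (Q *m (s - t)).
    by rewrite !fE opprD addrACA subrr addr0 mulmxBr scalerBr.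
  by rewrite dotZl dotZr dot_mulmx // mulrA.
have la2 : 0 < la ^+ 2 by rewrite exprn_gt0.
have f_neq s t : s != t -> f s <> f t.
  move=> st fst; have := dist s t; rewrite fst subrr dot0r => /esym/eqP.
  by rewrite mulf_eq0 gt_eqF //= dot_eq0 subr_eq0 (negbTE st).
have f_ratio s t u w : s \in S -> t \in S -> u \in S -> w \in S -> u != w ->
    (e * dot (f u - f w) (f u - f w) < dot (f s - f t) (f s - f t)) = false.
  move=> sS tS uS wS uw; apply/negbTE; rewrite -leNgt !dist mulrCA ler_pM2l //.
  exact: He.
have col s t : s \in S -> s != s0 -> t \in S -> t != s0 ->
    shell_colour N m (f s) = shell_colour N m (f t).
  move=> sS ss0 tS ts0.
  by apply: mono; split; [exists s|exact: f_neq|exists t|exact: f_neq].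
have other (r : seq 'cV[R]_d) : (size r <= 3)%N ->
    exists2 s, s \in S & s \notin r.
  move=> r3; apply/not_exists2P => H.
  suff /(uniq_leq_size (fset_uniq S)) : {subset enum_fset S <= r}.
    by move/(leq_trans S3)/leq_trans/(_ r3).
  by move=> s sS; have [//|/negP/negPn] := H s.
have shell_const s t : s \in S -> s != s0 -> t \in S -> t != s0 ->
    shell (f s) = shell (f t).
  move=> sS ss0 tS ts0; wlog lt : s t sS ss0 tS ts0 / (shell (f s) < shell (f t))%N.
    move=> H; case: (ltngtP (shell (f s)) (shell (f t))) => // lt.
      exact: H.
    by apply/esym/H.
  have st : s != t by apply: contraTneq lt => ->; rewrite ltnn.
  (* Here [S] must have more than three points: a third point besides [s0] is needed to contradict
     [three_same_colour]. *)
  have [r rS] := other [:: s0; s; t] isT.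
  rewrite !inE !negb_or => /and3P[rs0 rs rt].
  by have [] := three_same_colour N0 m0 e_ge0 eN em (col _ _ sS ss0 tS ts0)
    (col _ _ rS rs0 tS ts0) lt; rewrite f_ratio // eq_sym.
have [s1 s1S] := other [:: s0] isT; rewrite inE => s10.
have cell s : s \in S -> s != s0 -> same_cell N (f s1) (f s).
  move=> sS ss0; apply: (same_cellP (m := m)) => //.
    by apply: shell_const.
  by apply: col.
have cell0 : same_cell N (f s1) (f s0).
  (* The cell is convex and [f] affine, so its preimage is a convex set containing all points but
     [s0], hence [s0] as well. *)
  apply: (conv_hull_sub (M := f @^-1` same_cell N (f s1)) _ _ hull).
    have /convex_setP cvx := @convex_same_cell R d N (f s1).
    apply/convex_setP => x y l xc yc l0 l1.
    have := cvx _ _ l xc yc l0 l1; congr (same_cell _ _ _).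
    rewrite /preimage /= !fE mulmxDr -!scalemxAr !scalerDr addrACA !scalerA.
    by rewrite -scalerDl addrC [l * _]mulrC [(1 - l) * _]mulrC subrKC scale1r addrC.
  by move=> s [sS /eqP ss0]; apply: cell.
have col1 s : s \in S -> shell_colour N m (f s) = shell_colour N m (f s1).
  move=> sS; have [->|ss0] := eqVneq s s0; first exact: same_cell_colour.
  exact: col.
by apply: nmono => _ _ [s sS <-] [t tS <-]; rewrite !col1.
Qed.

End Construction.

(** Distinct lattice points have squared distance at least one, so bounding the largest squared
    distance suffices; the bound 5 exceeds the ratio 4 met in progressions. *)
Lemma bounded_ratio (R : realType) (d : nat) (S : {fset 'cV[R]_d}) :
  (forall x, x \in S -> x \is a mxOver Num.int) ->
  exists2 e : R, 5 <= e &
    forall s t u w, s \in S -> t \in S -> u \in S -> w \in S -> u != w ->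
      dot (s - t) (s - t) <= e * dot (u - w) (u - w).
Proof.
move=> S_int.
have [b b_ge0 Hb] := seq_bound [seq (s, t) | s <- enum_fset S, t <- enum_fset S]
  (fun p => dot (p.1 - p.2) (p.1 - p.2)).
exists (b + 5) => [|s t u w sS tS uS wS uw]; first by lra.
have /= st_le := Hb (s, t) (allpairs_f _ sS tS).
have uw_int : u - w \is a mxOver Num.int.
  apply/mxOverP => i j; rewrite mxE [X in _ + X]mxE rpredB //.
    by apply/mxOverP; apply: S_int.
  by apply/mxOverP; apply: S_int.
have uw_gt0 : 0 < dot (u - w) (u - w) by rewrite dot_gt0 ?subr_eq0.
have := int_lt_le (rpred0 _) (dot_int uw_int) uw_gt0; rewrite add0r => uw1.
by apply: le_trans st_le _; nra.
Qed.

Unset Implicit Arguments.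

Local Open Scope fset_scope.
Local Open Scope ring_scope.

Theorem theorem1p5 (R : realType) (d : nat) (hd : (1 <= d)%N)
    (S : {fset 'cV[R]_d})
    (S_int : forall x, x \in S -> x \is a mxOver Num.int)
    (S_card : (3 <= #|` S|)%N)
    (s0 : 'cV[R]_d) (Ss0 : s0 \in S) :
  (exists (k : nat) (chi : 'cV[R]_d -> 'I_k),
     AP_free chi /\
     forall T t0, similar_copy [set` S] s0 T t0 ->
       ~ almost_monochromatic chi T t0) <->
  ((3 < #|` S|)%N /\ ~ extreme_point [set` S] s0).
Proof.
split=> [[k [chi [apfree free]]]|[S3 /contrapT hull]].
  have not_ext : ~ extreme_point [set` S] s0.
    move=> ext; have [s1 s1S s10] : exists2 s1, s1 \in S & s1 != s0.
      apply/not_exists2P => H.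
      suff /(uniq_leq_size (fset_uniq S)) : {subset enum_fset S <= [:: s0]}.
        by move/(leq_trans S_card).
      by move=> s sS; rewrite inE; have [//|/negP/negPn] := H s.
    exact: extreme_not_AP_free hd S_int Ss0 s1S s10 ext free apfree.
  split=> //; rewrite ltn_neqAle S_card andbT; apply/eqP => S3.
  exact: three_points_not_AP_free S_int (esym S3) Ss0 not_ext free apfree.
have [e e5 He] := bounded_ratio S_int.
(* One [K] serves both as the fineness of the cells and as the spacing of the shells, since its
   square and [2 ^ K] are both at least [K]. *)
have [K [K_gt0 eK]] : exists K, (0 < K)%N /\ 16 * d%:R * e < K%:R.
  exists (Num.bound (16 * d%:R * e)).+1; split=> //.
  rewrite (lt_trans (archi_boundP _)) ?ltr_nat // !mulr_ge0 //; lra.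
have K1 : 1 <= K%:R :> R by rewrite ler1n.
have eN : 16 * d%:R * e < K%:R ^+ 2 by apply: lt_le_trans eK _; nra.
have em : 16 * d%:R * e < (2 ^+ K) ^+ 2.
  have K2 : K%:R <= (2 ^ K)%:R :> R.
    by rewrite ler_nat; exact: ltnW (ltn_expl K _).
  rewrite natrX in K2; have P1 := le_trans K1 K2.
  apply: lt_le_trans eK _; apply: (le_trans K2).
  by rewrite expr2 ler_peMr ?(le_trans ler01 P1).
pose chi := @shell_colour R d K K.
(* The colours are numbered by [enum_rank]; its injectivity preserves monochromatic sets both
   ways. *)
exists _, (enum_rank \o chi).
have monoE A : monochromatic (enum_rank \o chi) A <-> monochromatic chi A.
  by split=> H x y Ax Ay; [apply: enum_rank_inj; apply: H|rewrite /= (H x y)].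
split=> [A /(shell_colour_AP_free K_gt0 K_gt0 e5 eN em) nmono /monoE|
    T t0 copy [Tt0 /monoE m1 m2]].
  exact: nmono.
apply: (shell_colour_AM_free K_gt0 K_gt0 e5 eN em He S3 Ss0 hull copy) => //.
by split=> // /monoE.
Qed.
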